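(* In scheme (G) of the context choose $\bar\lambda_{k+1}=\lambda_k+\frac{\alpha_k}{\theta_k}(Av_k+Bw_{k+1}-b)$. Then (G) becomes the following algorithm: $$\begin{cases}\widehat\lambda_k=\lambda_k-\theta_k^{-1}(Ax_k+By_k-b)+\frac{\alpha_k}{\theta_k}A(v_k-x_k),\\ y_{k+1}=\operatorname{argmin}_{y\in\mathcal Y}\left\{\mathcal L_{\sigma_k}(x_k,y,\widehat\lambda_k)+\frac{\eta_{g,k}}{2\alpha_k^2}\|y-\widetilde y_k\|^2\right\},\quad\sigma_k=1/\theta_{k+1},\\ w_{k+1}=y_{k+1}+(y_{k+1}-y_k)/\alpha_k,\\ \bar\lambda_{k+1}=\lambda_k+\frac{\alpha_k}{\theta_k}(Av_k+Bw_{k+1}-b),\\ x_{k+1}=\operatorname{prox}^{\mathcal X}_{s_kf}(\widetilde x_k-s_kA^\top\bar\lambda_{k+1}),\quad s_k=\alpha_k^2/\eta_{f,k},\\ v_{k+1}=x_{k+1}+(x_{k+1}-x_k)/\alpha_k,\\ \lambda_{k+1}=\lambda_k+\frac{\alpha_k}{\theta_k}(Av_{k+1}+Bw_{k+1}-b).\end{cases}$$ Assume in addition that $f\in\mathcal S^0_{\mu_f}(\mathcal X)$, $g\in\mathcal S^0_{\mu_g}(\mathcal Y)$ with $\mu_f,\mu_g\ge0$, that $\gamma_0=\mu_f$ if $\mu_f>0$ and $\beta_0=\mu_g$ if $\mu_g>0$, and that the step sizes satisfy $\alpha_k^2\|A\|^2=\gamma_k\theta_k$ for all $k$. Then $\{(x_k,y_k)\}_{k\ge1}\subset\mathcal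 X\times\mathcal Y$ and $$\|Ax_k+By_k-b\|\le\theta_k\mathcal R_0,\qquad \mathcal L(x_k,y_k,\lambda^* )-\mathcal L(x^*,y^*,\lambda_k)\le\theta_k\mathcal E_0,\qquad |F(x_k,y_k)-F^*|\le\theta_k(\mathcal E_0+\|\lambda^*\|\mathcal R_0),$$ where $\mathcal R_0=\sqrt{2\mathcal E_0}+\|\lambda_0-\lambda^*\|+\|Ax_0+By_0-b\|$, and $$\theta_k\le\min\left\{\frac{Q}{Q+\sqrt{\gamma_0}\,k},\ \frac{4Q^2}{(2Q+\sqrt{\mu_f}\,k)^2}\right\},\qquad Q=\|A\|+\sqrt{\gamma_0}.$$
   Context: Setting. $\mathcal X\subset\mathbb R^m$, $\mathcal Y\subset\mathbb R^n$ are closed convex sets, $A\in\mathbb R^{r\times m}$, $B\in\mathbb R^{r\times n}$, $b\in\mathbb R^r$, and $f:\mathbb R^m\to\mathbb R\cup\{+\infty\}$, $g:\mathbb R^n\to\mathbb R\cup\{+\infty\}$ are proper closed convex. The problem is to minimize $F(x,y)=f(x)+g(y)$ over $x\in\mathcal X,y\in\mathcal Y$ subject to $Ax+By=b$. $\mathcal L(x,y,\lambda)=F(x,y)+\delta_{\mathcal X\times\mathcal Y}(x,y)+\langle\lambda,Ax+By-b\rangle$ ($\delta$: indicator function) and $\mathcal L_\sigma(x,y,\lambda)=\mathcal L(x,y,\lambda)+\frac\sigma2\|Ax+By-b\|^2$. $(x^*,y^*,\lambda^* )\in\mathcal X\times\mathcal Y\times\mathbb R^r$ is a saddle point of $\mathcal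 L$ (assumed to exist): $\mathcal L(x^*,y^*,\lambda)\le\mathcal L(x^*,y^*,\lambda^* )\le\mathcal L(x,y,\lambda^* )$ for all $(x,y,\lambda)$; $F^*=F(x^*,y^* )$. Norms are Euclidean, and $\|A\|,\|B\|$ are the induced operator norms. $f\in\mathcal S^0_\mu(\mathcal X)$ means $f(x_1)-f(x_2)-\langle p,x_1-x_2\rangle\ge\frac\mu2\|x_1-x_2\|^2$ for all $x_1,x_2\in\mathcal X$, $p\in\partial f(x_2)$; $\mathcal S^0_\mu(\mathcal Y)$ is analogous. $\operatorname{prox}^{\mathcal X}_{sf}(z)=\operatorname{argmin}_{x\in\mathcal X}\{f(x)+\frac1{2s}\|x-z\|^2\}$. Parameters. $\theta_0=1$, $\gamma_0>0$, $\beta_0>0$, step sizes $\alpha_k>0$, and $$\frac{\theta_{k+1}-\theta_k}{\alpha_k}=-\theta_{k+1},\quad\frac{\gamma_{k+1}-\gamma_k}{\alpha_k}=\mu_f-\gamma_{k+1},\quad\frac{\beta_{k+1}-\beta_k}{\alpha_k}=\mu_g-\beta_{k+1}.$$ $\eta_{f,k}=(\alpha_k+1)\gamma_k+\mu_f\alpha_k$, $\eta_{g,k}=(\alpha_k+1)\beta_k+\mu_g\alpha_k$, $\widetilde x_k=x_k+\frac{\alpha_k\gamma_k}{\eta_{f,k}}(v_k-x_k)$, $\widetilde y_k=y_k+\frac{\alpha_k\beta_k}{\eta_{g,k}}(w_k-y_k)$. Scheme (G), from an initial guess $(x_0,v_0,y_0,w_0,\lambda_0)$; it is implicit, with the value $\bar\lambda_{k+1}$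 (to be chosen) treated as a fixed vector inside the argmins: $$\begin{cases}v_{k+1}=x_{k+1}+(x_{k+1}-x_k)/\alpha_k,\\ x_{k+1}=\operatorname{argmin}_{x\in\mathcal X}\{\mathcal L(x,y_{k+1},\bar\lambda_{k+1})+\frac{\eta_{f,k}}{2\alpha_k^2}\|x-\widetilde x_k\|^2\},\\ \lambda_{k+1}=\lambda_k+\frac{\alpha_k}{\theta_k}(Av_{k+1}+Bw_{k+1}-b),\\ y_{k+1}=\operatorname{argmin}_{y\in\mathcal Y}\{\mathcal L(x_{k+1},y,\bar\lambda_{k+1})+\frac{\eta_{g,k}}{2\alpha_k^2}\|y-\widetilde y_k\|^2\},\\ w_{k+1}=y_{k+1}+(y_{k+1}-y_k)/\alpha_k.\end{cases}$$ Discrete Lyapunov function: $\mathcal E_k=\mathcal L(x_k,y_k,\lambda^* )-\mathcal L(x^*,y^*,\lambda_k)+\frac{\gamma_k}2\|v_k-x^*\|^2+\frac{\beta_k}2\|w_k-y^*\|^2+\frac{\theta_k}2\|\lambda_k-\lambda^*\|^2$.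
   Formalization: The subdifferential in S^0_mu is that of f (resp. g) restricted to X (resp. Y), as the rates can fail when ∂f is empty on X; the equivalence of (G) and the algorithm assumes x_0 in X, f(x_0) finite and mu_f, mu_g >= 0; F* is assumed finite. *)

(* Defs.v *)
From mathcomp Require Import all_boot all_order all_algebra.
From mathcomp Require Import all_classical all_reals all_analysis.

Set Implicit Arguments.
Unset Strict Implicit.
Unset Printing Implicit Defensive.
Import Order.TTheory GRing.Theory Num.Theory.
Import numFieldNormedType.Exports.

Local Open Scope classical_set_scope.
Local Open Scope ring_scope.

(* The library norm on 'cV[R]_d is the sup norm, so the Euclidean structure is
   introduced here.  The topology used by [closed] below is the same for both
   norms. *)
Definition dotp (R : realType) (d : nat) (u v : 'cV[R]_d) : R :=
  \sum_(i < d) u i 0 * v i 0.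

Definition enorm (R : realType) (d : nat) (u : 'cV[R]_d) : R :=
  Num.sqrt (dotp u u).

Definition opnorm (R : realType) (d e : nat) (M : 'M[R]_(d, e)) : R :=
  sup [set enorm (M *m u) | u in [set u : 'cV[R]_e | enorm u <= 1]].

Definition proper (R : realType) (d : nat) (h : 'cV[R]_d -> \bar R) : Prop :=
  (forall u, h u != -oo%E) /\ exists u, (h u < +oo)%E.

Definition epigraph (R : realType) (d : nat) (h : 'cV[R]_d -> \bar R) :
    set ('cV[R]_d * R) :=
  [set z | (h z.1 <= z.2%:E)%E].

Definition proper_closed_convex (R : realType) (d : nat)
    (h : 'cV[R]_d -> \bar R) : Prop :=
  [/\ proper h, closed (epigraph h) &
      @convex_set R ('cV[R]_d * R)%type (epigraph h)].

Definition indicator (R : realType) (T : Type) (D : set T) (u : T) : \bar R :=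
  if u \in D then 0%E else +oo%E.

(* The argmin of a function that is identically +oo on [D] is empty. *)
Definition argmin (R : realType) (d : nat) (D : set 'cV[R]_d)
    (phi : 'cV[R]_d -> \bar R) : set 'cV[R]_d :=
  [set u | [/\ D u, (phi u < +oo)%E & forall z, D z -> (phi u <= phi z)%E]].

Definition prox (R : realType) (d : nat) (D : set 'cV[R]_d) (s : R)
    (h : 'cV[R]_d -> \bar R) (z : 'cV[R]_d) : set 'cV[R]_d :=
  argmin D (fun u => (h u + ((2 * s)^-1 * enorm (u - z) ^+ 2)%:E)%E).

(* Subgradients at [u] of [h] regarded as a function on [D]. *)
Definition subdiff (R : realType) (d : nat) (D : set 'cV[R]_d)
    (h : 'cV[R]_d -> \bar R) (u : 'cV[R]_d) : set 'cV[R]_d :=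
  [set p | [/\ D u, h u \is a fin_num &
               forall z, D z -> (h u + (dotp p (z - u))%:E <= h z)%E]].

Definition normal_cone (R : realType) (d : nat) (D : set 'cV[R]_d)
    (u : 'cV[R]_d) : set 'cV[R]_d :=
  [set p | forall z, D z -> dotp p (z - u) <= 0].

(* The class S^0_mu(D).  Subgradients are those of [h] as a function on [D],
   i.e. of h + delta_D.  With subgradients of [h] over the whole space the
   condition can be void: h(a, c) = - sqrt c (and +oo for c < 0) has no
   subgradient at any point of D = {c = 0}, where it vanishes identically.
   The two versions agree whenever the sum rule for h + delta_D holds, see
   [strongly_convex_on_sum_rule]. *)
Definition strongly_convex_on (R : realType) (d : nat) (D : set 'cV[R]_d)
    (mu : R) (h : 'cV[R]_d -> \bar R) : Prop :=
  forall u1 u2 p, D u1 -> D u2 -> subdiff D h u2 p ->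
    ((mu / 2 * enorm (u1 - u2) ^+ 2)%:E
       <= h u1 - h u2 - (dotp p (u1 - u2))%:E)%E.

Lemma dotpDl (R : realType) (d : nat) (p q u : 'cV[R]_d) :
  dotp (p + q) u = dotp p u + dotp q u.
Proof.
by rewrite /dotp -big_split; apply: eq_bigr => i _ /=; rewrite mxE mulrDl.
Qed.

Lemma strongly_convex_on_sum_rule (R : realType) (d : nat) (D : set 'cV[R]_d)
    (mu : R) (h : 'cV[R]_d -> \bar R) :
  (forall u, D u ->
     subdiff D h u
       `<=` [set p + q | p in subdiff setT h u & q in normal_cone D u]) ->
  strongly_convex_on D mu h <->
  (forall u1 u2 p, D u1 -> D u2 -> subdiff setT h u2 p ->
     ((mu / 2 * enorm (u1 - u2) ^+ 2)%:E
        <= h u1 - h u2 - (dotp p (u1 - u2))%:E)%E).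
Proof.
move=> sum_rule; split=> H u1 u2 p D1 D2.
  by case=> _ h2 hp; apply: H => //; split=> // z _; apply: hp.
move=> /(sum_rule _ D2)[p' hp' [q hq <-]].
apply: (le_trans (H u1 u2 p' D1 D2 hp')).
by rewrite leeB // lee_fin dotpDl gerDl hq.
Qed.

Record problem (R : realType) (m n r : nat) := Problem {
  pX : set 'cV[R]_m;
  pY : set 'cV[R]_n;
  pA : 'M[R]_(r, m);
  pB : 'M[R]_(r, n);
  pb : 'cV[R]_r;
  pf : 'cV[R]_m -> \bar R;
  pg : 'cV[R]_n -> \bar R }.

Record params (R : realType) := Params {
  mu_f : R;
  mu_g : R;
  alpha : nat -> R;
  theta : nat -> R;
  gamma : nat -> R;
  beta : nat -> R }.

Record iterates (R : realType) (m n r : nat) := Iterates {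
  it_x : nat -> 'cV[R]_m;
  it_v : nat -> 'cV[R]_m;
  it_y : nat -> 'cV[R]_n;
  it_w : nat -> 'cV[R]_n;
  it_lam : nat -> 'cV[R]_r }.

Definition convex_problem (R : realType) (m n r : nat) (P : problem R m n r) :
    Prop :=
  [/\ closed (pX P) /\ convex_set (pX P),
      closed (pY P) /\ convex_set (pY P),
      proper_closed_convex (pf P) & proper_closed_convex (pg P)].

Section Lagrangian.
Context (R : realType) (m n r : nat) (P : problem R m n r).
Implicit Types (x : 'cV[R]_m) (y : 'cV[R]_n) (lam : 'cV[R]_r).

Definition objective x y : \bar R := (pf P x + pg P y)%E.

Definition residual x y : 'cV[R]_r := pA P *m x + pB P *m y - pb P.

Definition lagr x y lam : \bar R :=
  (objective x y + indicator R (pX P `*` pY P) (x, y)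
   + (dotp lam (residual x y))%:E)%E.

Definition aug_lagr (sigma : R) x y lam : \bar R :=
  (lagr x y lam + (sigma / 2 * enorm (residual x y) ^+ 2)%:E)%E.

Definition saddle_point xs ys lams : Prop :=
  [/\ pX P xs, pY P ys,
      forall lam, (lagr xs ys lam <= lagr xs ys lams)%E &
      forall x y, (lagr xs ys lams <= lagr x y lams)%E].

End Lagrangian.

Record param_system (R : realType) (c : params R) : Prop := ParamSystem {
  theta_init : theta c 0 = 1;
  gamma_init : 0 < gamma c 0;
  beta_init : 0 < beta c 0;
  alpha_gt0 : forall k, 0 < alpha c k;
  theta_rec : forall k,
    (theta c k.+1 - theta c k) / alpha c k = - theta c k.+1;
  gamma_rec : forall k,
    (gamma c k.+1 - gamma c k) / alpha c k = mu_f c - gamma c k.+1;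
  beta_rec : forall k,
    (beta c k.+1 - beta c k) / alpha c k = mu_g c - beta c k.+1 }.

Section Schemes.
Context (R : realType) (m n r : nat).
Context (P : problem R m n r) (c : params R) (s : iterates R m n r).

Let A := pA P.
Let B := pB P.
Let b := pb P.
Let x := it_x s.
Let v := it_v s.
Let y := it_y s.
Let w := it_w s.
Let lam := it_lam s.
Let al := alpha c.
Let th := theta c.

Definition eta_f k : R := (al k + 1) * gamma c k + mu_f c * al k.
Definition eta_g k : R := (al k + 1) * beta c k + mu_g c * al k.

Definition x_tilde k : 'cV[R]_m :=
  x k + (al k * gamma c k / eta_f k) *: (v k - x k).
Definition y_tilde k : 'cV[R]_n :=
  y k + (al k * beta c k / eta_g k) *: (w k - y k).

Definition lam_hat k : 'cV[R]_r :=
  lam k - (th k)^-1 *: residual P (x k) (y k)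
  + (al k / th k) *: (A *m (v k - x k)).

(* Scheme (G); [lbar k.+1] is the multiplier used to compute the iterate of
   index k.+1, and [lbar 0] is not used. *)
Record scheme_G (lbar : nat -> 'cV[R]_r) : Prop := SchemeG {
  G_v : forall k, v k.+1 = x k.+1 + (al k)^-1 *: (x k.+1 - x k);
  G_x : forall k,
    argmin (pX P) (fun u => (lagr P u (y k.+1) (lbar k.+1)
      + (eta_f k / (2 * al k ^+ 2) * enorm (u - x_tilde k) ^+ 2)%:E)%E)
      (x k.+1);
  G_lam : forall k, lam k.+1 =
    lam k + (al k / th k) *: (A *m v k.+1 + B *m w k.+1 - b);
  G_y : forall k,
    argmin (pY P) (fun u => (lagr P (x k.+1) u (lbar k.+1)
      + (eta_g k / (2 * al k ^+ 2) * enorm (u - y_tilde k) ^+ 2)%:E)%E)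
      (y k.+1);
  G_w : forall k, w k.+1 = y k.+1 + (al k)^-1 *: (y k.+1 - y k) }.

Definition lbar_choice (lbar : nat -> 'cV[R]_r) : Prop :=
  forall k, lbar k.+1 =
    lam k + (al k / th k) *: (A *m v k + B *m w k.+1 - b).

Record algorithm (lbar : nat -> 'cV[R]_r) : Prop := Algorithm {
  alg_y : forall k,
    argmin (pY P) (fun u => (aug_lagr P (th k.+1)^-1 (x k) u (lam_hat k)
      + (eta_g k / (2 * al k ^+ 2) * enorm (u - y_tilde k) ^+ 2)%:E)%E)
      (y k.+1);
  alg_w : forall k, w k.+1 = y k.+1 + (al k)^-1 *: (y k.+1 - y k);
  alg_lbar : lbar_choice lbar;
  alg_x : forall k, let s_k := al k ^+ 2 / eta_f k in
    prox (pX P) s_k (pf P) (x_tilde k - s_k *: (A^T *m lbar k.+1)) (x k.+1);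
  alg_v : forall k, v k.+1 = x k.+1 + (al k)^-1 *: (x k.+1 - x k);
  alg_lam : forall k, lam k.+1 =
    lam k + (al k / th k) *: (A *m v k.+1 + B *m w k.+1 - b) }.

(* Extended-real valued: it is +oo at k = 0 when the initial guess is outside
   the domain of the problem. *)
Definition lyapunov (xs : 'cV[R]_m) (ys : 'cV[R]_n) (lams : 'cV[R]_r) k :
    \bar R :=
  (lagr P (x k) (y k) lams - lagr P xs ys (lam k)
   + (gamma c k / 2 * enorm (v k - xs) ^+ 2
      + beta c k / 2 * enorm (w k - ys) ^+ 2
      + th k / 2 * enorm (lam k - lams) ^+ 2)%:E)%E.

Definition R_zero (xs : 'cV[R]_m) (ys : 'cV[R]_n) (lams : 'cV[R]_r) : \bar R :=
  (sqrte (2%:E * lyapunov xs ys lams 0)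
   + (enorm (lam 0 - lams) + enorm (residual P (x 0) (y 0)))%:E)%E.

End Schemes.

(* Main.v *)
Require Import Defs.
From mathcomp Require Import all_boot all_order all_algebra.
From mathcomp Require Import all_classical all_reals all_analysis.
From mathcomp Require Import ring lra.
Set Implicit Arguments.
Unset Strict Implicit.
Unset Printing Implicit Defensive.

Import Order.TTheory GRing.Theory Num.Theory.
Import numFieldNormedType.Exports.

Local Open Scope classical_set_scope.
Local Open Scope ring_scope.

(** The Lyapunov function satisfies (1 + alpha_k) E_{k+1} <= E_k, hence
    E_k <= theta_k E_0.  The x- and y-steps are optimality conditions
    -(gamma_k (v_{k+1} - v_k) / alpha_k + mu_f (v_{k+1} - x_{k+1})
      + A^T lbar_{k+1}) \in subdiff f x_{k+1}
    (and likewise for g); testing them at x* and at x_k produces the decay up to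
    a term alpha_k <lambda_{k+1} - lbar_{k+1}, A v_{k+1} + B w_{k+1} - b>, which
    the step-size rule alpha_k^2 ||A||^2 = gamma_k theta_k lets the quadratic
    terms absorb.  The residual estimate comes from the telescoping identity
    lambda_k - lambda_0 = theta_k^-1 (A x_k + B y_k - b) - (A x_0 + B y_0 - b).
    The two forms of the scheme agree because, for a convex function plus a
    convex quadratic, being an argmin is equivalent to the first-order
    condition, and the gradients at the new iterates coincide. *)

(** * Euclidean geometry: inner product, norm and induced operator norm *)

Section Euclidean.
Context {R : realType}.
Implicit Types (d e : nat) (a : R).

Lemma dotpE d (u v : 'cV[R]_d) : dotp u v = (u^T *m v) 0 0.
Proof. by rewrite mxE; apply: eq_bigr => i _; rewrite mxE. Qed.

Lemma dotpC d (u v : 'cV[R]_d) : dotp u v = dotp v u.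
Proof. by apply: eq_bigr => i _; rewrite mulrC. Qed.

Lemma dotpZl d a (u v : 'cV[R]_d) : dotp (a *: u) v = a * dotp u v.
Proof. by rewrite mulr_sumr; apply: eq_bigr => i _; rewrite mxE mulrA. Qed.

Lemma dotpZr d a (u v : 'cV[R]_d) : dotp u (a *: v) = a * dotp u v.
Proof. by rewrite dotpC dotpZl dotpC. Qed.

Lemma dotpDr d (u v w : 'cV[R]_d) : dotp u (v + w) = dotp u v + dotp u w.
Proof. by rewrite dotpC dotpDl !(dotpC u). Qed.

Lemma dotpNl d (u v : 'cV[R]_d) : dotp (- u) v = - dotp u v.
Proof. by rewrite -scaleN1r dotpZl mulN1r. Qed.

Lemma dotpNr d (u v : 'cV[R]_d) : dotp u (- v) = - dotp u v.
Proof. by rewrite dotpC dotpNl dotpC. Qed.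

Lemma dotp0r d (u : 'cV[R]_d) : dotp u 0 = 0.
Proof. by rewrite -(scale0r u) dotpZr mul0r. Qed.

Lemma dotp0l d (u : 'cV[R]_d) : dotp 0 u = 0.
Proof. by rewrite dotpC dotp0r. Qed.

Definition dotp_lin := (dotpDl, dotpDr, dotpNl, dotpNr, dotpZl, dotpZr).

Lemma dotp_mulmx d e (M : 'M[R]_(d, e)) u v :
  dotp u (M *m v) = dotp (M^T *m u) v.
Proof. by rewrite !dotpE trmx_mul trmxK mulmxA. Qed.

Lemma dotp_ge0 d (u : 'cV[R]_d) : 0 <= dotp u u.
Proof. by apply: sumr_ge0 => i _; rewrite -expr2 sqr_ge0. Qed.

Lemma dotp_eq0 d (u : 'cV[R]_d) : (dotp u u == 0) = (u == 0).
Proof.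
apply/eqP/eqP => [/eqP|->]; last exact: dotp0l.
rewrite psumr_eq0 => [/allP u0|i _]; last by rewrite -expr2 sqr_ge0.
apply/colP => i; rewrite mxE; apply/eqP.
by move: (u0 i (mem_index_enum i)); rewrite mulf_eq0 orbb.
Qed.

Lemma enorm_ge0 d (u : 'cV[R]_d) : 0 <= enorm u.
Proof. exact: sqrtr_ge0. Qed.

Lemma sqr_enorm d (u : 'cV[R]_d) : enorm u ^+ 2 = dotp u u.
Proof. by rewrite sqr_sqrtr ?dotp_ge0. Qed.

Lemma enorm_eq0 d (u : 'cV[R]_d) : (enorm u == 0) = (u == 0).
Proof. by rewrite -dotp_eq0 -sqr_enorm sqrf_eq0. Qed.

Lemma enorm0 d : enorm (0 : 'cV[R]_d) = 0.
Proof. by apply/eqP; rewrite enorm_eq0. Qed.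

Lemma enormZ d a (u : 'cV[R]_d) : enorm (a *: u) = `|a| * enorm u.
Proof.
by rewrite /enorm dotpZl dotpZr mulrA -expr2 sqrtrM ?sqr_ge0// sqrtr_sqr.
Qed.

(** Cauchy-Schwarz: the squared norm of [enorm v *: u - enorm u *: v] is [2 * (enorm u * enorm v)]
    times the defect [enorm u * enorm v - dotp u v]. Zero vectors are split off so that this factor
    can be cancelled. *)
Lemma dotp_le_enorm d (u v : 'cV[R]_d) : dotp u v <= enorm u * enorm v.
Proof.
have [->|u0] := eqVneq u 0; first by rewrite dotp0l enorm0 mul0r.
have [->|v0] := eqVneq v 0; first by rewrite dotp0r enorm0 mulr0.
have up : 0 < enorm u by rewrite lt_neqAle enorm_ge0 eq_sym enorm_eq0 u0.
have vp : 0 < enorm v by rewrite lt_neqAle enorm_ge0 eq_sym enorm_eq0 v0.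
have H : dotp (enorm v *: u - enorm u *: v) (enorm v *: u - enorm u *: v) =
    2 * (enorm u * enorm v) * (enorm u * enorm v - dotp u v).
  by rewrite !dotp_lin (dotpC v u) -!sqr_enorm; ring.
rewrite -subr_ge0 -(@pmulr_rge0 _ (2 * (enorm u * enorm v))) ?mulr_gt0//.
by rewrite -H dotp_ge0.
Qed.

Lemma normr_dotp_le d (u v : 'cV[R]_d) : `|dotp u v| <= enorm u * enorm v.
Proof.
rewrite ler_norml dotp_le_enorm andbT lerNl -dotpNl.
rewrite (le_trans (dotp_le_enorm _ _))// -scaleN1r enormZ.
by rewrite normrN normr1 mul1r.
Qed.

Lemma ler_enormD d (u v : 'cV[R]_d) : enorm (u + v) <= enorm u + enorm v.
Proof.
rewrite -ler_sqr ?nnegrE ?addr_ge0 ?enorm_ge0// sqrrD !sqr_enorm !dotp_lin.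
by have := dotp_le_enorm u v; rewrite (dotpC v u); lra.
Qed.

Lemma enormN d (u : 'cV[R]_d) : enorm (- u) = enorm u.
Proof. by rewrite -scaleN1r enormZ normrN normr1 mul1r. Qed.

(** [sup] is meaningful only on a nonempty set that is bounded above. Cauchy-Schwarz on each row
    bounds the set by the Frobenius norm [Num.sqrt K]. *)
Lemma opnorm_has_sup d e (M : 'M[R]_(d, e)) :
  has_sup [set enorm (M *m u) | u in [set u : 'cV[R]_e | enorm u <= 1]].
Proof.
pose K := \sum_(i < d) enorm (row i M)^T ^+ 2.
have K0 : 0 <= K by apply: sumr_ge0 => i _; rewrite sqr_ge0.
split; first by exists (enorm (M *m 0)), 0; rewrite //= enorm0.
exists (Num.sqrt K) => _ [z /= z1 <-].
rewrite ler_sqrt// /dotp; apply: ler_sum => i _.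
have -> : (M *m z) i 0 = dotp (row i M)^T z.
  by rewrite dotpE trmxK -row_mul [RHS]mxE.
rewrite -expr2 -[leLHS]ger0_norm ?sqr_ge0// normrX.
rewrite ler_sqr ?nnegrE ?normr_ge0 ?enorm_ge0//.
by rewrite (le_trans (normr_dotp_le _ _))// ler_piMr ?enorm_ge0.
Qed.

Lemma opnorm_ge0 d e (M : 'M[R]_(d, e)) : 0 <= opnorm M.
Proof.
apply: (sup_upper_bound (opnorm_has_sup M)).
by exists 0; rewrite /= ?mulmx0 enorm0.
Qed.

Lemma enorm_mulmx_le d e (M : 'M[R]_(d, e)) u :
  enorm (M *m u) <= opnorm M * enorm u.
Proof.
have [->|u0] := eqVneq u 0; first by rewrite mulmx0 !enorm0 mulr0.
have up : 0 < enorm u by rewrite lt_neqAle enorm_ge0 eq_sym enorm_eq0 u0.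
have : enorm (M *m ((enorm u)^-1 *: u)) <= opnorm M.
  apply: (sup_upper_bound (opnorm_has_sup M)).
  exists ((enorm u)^-1 *: u) => //=.
  by rewrite enormZ gtr0_norm ?invr_gt0// mulVf ?gt_eqF.
rewrite -scalemxAr enormZ gtr0_norm ?invr_gt0//.
by rewrite mulrC ler_pdivrMr.
Qed.

End Euclidean.

(** * First-order characterization of constrained minimizers *)

Section Argmin.
Context {R : realType} {d : nat}.
Implicit Types (D : set 'cV[R]_d) (h : 'cV[R]_d -> \bar R) (u z p : 'cV[R]_d).

Lemma eq_argmin D phi psi u : (forall z, D z -> phi z = psi z) ->
  argmin D phi u <-> argmin D psi u.
Proof.
move=> E; split=> -[Du fu mu]; split=> [//||z Dz].
- by rewrite -E.
- by rewrite -!E// mu.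
- by rewrite E.
- by rewrite !E// mu.
Qed.

Lemma convex_set_segment (M : lmodType R) (D : set M) (a b : M) (t : R) :
  @convex_set R M D -> D a -> D b -> 0 <= t -> t <= 1 ->
  D (t *: a + (1 - t) *: b).
Proof.
move=> cD Da Db t0 t1.
have t01 : (0 <= t <= 1)%R by rewrite t0.
have := cD a b (Itv01 t0 t1).
by rewrite !inE => /(_ Da Db).
Qed.

(** Here [q] has gradient [p] at [u], with a nonnegative remainder [rho] homogeneous of degree two.
    Minimality yields the subgradient inequality in the limit along segments inside [D]; conversely,
    [rho >= 0] puts [q] above its linearization. *)
Lemma argmin_smooth D h q p (rho : 'cV[R]_d -> R) u :
  convex_set D -> @convex_set R ('cV[R]_d * R)%type (epigraph h) ->
  (forall z, h z != -oo%E) ->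
  (forall z, q z = q u + dotp p (z - u) + rho (z - u)) ->
  (forall z, 0 <= rho z) -> (forall t z, rho (t *: z) = t ^+ 2 * rho z) ->
  argmin D (fun z => h z + (q z)%:E)%E u <-> subdiff D h u (- p).
Proof.
move=> cD ch hNy qE rho0 rhoZ; split=> -[Du].
  move=> huy min_u.
  have hu : h u \is a fin_num.
    by rewrite fin_numE hNy; apply: contraTneq huy => ->.
  split=> // z Dz.
  have [->|hzy] := eqVneq (h z) +oo%E; first by rewrite leey.
  have hz : h z \is a fin_num by rewrite fin_numE hNy.
  (* Compare u with u + t (z - u), divide by t and let t tend to 0. *)
  have hE : forall t : R, 0 <= t -> t <= 1 ->
    (h (t *: z + (1 - t) *: u)%R <=
       (t * fine (h z) + (1 - t) * fine (h u))%:E)%E.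
    move=> t t0 t1.
    have := @convex_set_segment ('cV[R]_d * R)%type _
      (z, fine (h z)) (u, fine (h u)) t ch.
    by apply=> //; rewrite /epigraph/= fineK.
  have H : forall t : R, 0 < t -> t <= 1 ->
    0 <= fine (h z) - fine (h u) + dotp p (z - u) + t * rho (z - u).
    move=> t t0 t1.
    have := min_u _ (convex_set_segment cD Dz Du (ltW t0) t1).
    set zt := (t *: z + (1 - t) *: u)%R.
    have ztE : zt - u = t *: (z - u).
      by rewrite /zt scalerBl scale1r scalerBr addrA addrAC addrK addrC.
    have := hE t (ltW t0) t1; rewrite -/zt => ht.
    have htf : h zt \is a fin_num.
      by rewrite fin_numE hNy; apply: contraTneq ht => ->; rewrite leye_eq.
    rewrite -(fineK htf) lee_fin in ht.
    rewrite -(fineK hu) -(fineK htf) -!EFinD lee_fin (qE zt) ztE dotpZr rhoZ.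
    by move=> mt; rewrite -(pmulr_rge0 _ t0); nra.
  rewrite -(fineK hz) -(fineK hu) -EFinD lee_fin dotpNl.
  rewrite -subr_ge0; apply/ler_addgt0Pl => e e0; rewrite addrC.
  have r0 : 0 < rho (z - u) + 1 by rewrite ltr_wpDl// ltr01.
  (* This [t] makes the remainder [t * rho (z - u)] at most [e]; the [+ 1] keeps the denominator
     positive when [rho] vanishes. *)
  pose t := Num.min 1 (e / (rho (z - u) + 1)).
  have t0 : 0 < t by rewrite lt_min ltr01 divr_gt0.
  have t1 : t <= 1 by rewrite ge_min lexx.
  have te : t * rho (z - u) <= e.
    rewrite (@le_trans _ _ (t * (rho (z - u) + 1)))//.
      by rewrite ler_wpM2l ?lerDl// ltW.
    by rewrite -ler_pdivlMr // ge_min lexx orbT.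
  by have := H t t0 t1; lra.
move=> hu sub_u; split=> //; first by rewrite -(fineK hu) -EFinD ltry.
move=> z Dz; have := sub_u z Dz.
have [->|hzy] := eqVneq (h z) +oo%E; first by rewrite addye ?leey.
have hz : h z \is a fin_num by rewrite fin_numE hNy.
rewrite -(fineK hz) -(fineK hu) -!EFinD !lee_fin dotpNl (qE z).
by have := rho0 (z - u); lra.
Qed.

Lemma argmin_quadratic e D h (k c sg : R) p z0 (M : 'M[R]_(e, d)) b u :
  convex_set D -> @convex_set R ('cV[R]_d * R)%type (epigraph h) ->
  (forall z, h z != -oo%E) -> 0 <= c -> 0 <= sg ->
  argmin D (fun z => h z + (k + dotp p z + c / 2 * enorm (z - z0) ^+ 2
                            + sg / 2 * enorm (M *m z - b) ^+ 2)%:E)%E u <->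
  subdiff D h u (- (p + c *: (u - z0) + sg *: (M^T *m (M *m u - b)))).
Proof.
move=> cD ch hNy c0 sg0.
apply: (@argmin_smooth _ _ (fun z => k + dotp p z + c / 2 * enorm (z - z0) ^+ 2
    + sg / 2 * enorm (M *m z - b) ^+ 2) _
  (fun w => c / 2 * enorm w ^+ 2 + sg / 2 * enorm (M *m w) ^+ 2)) => //.
- move=> z.
  have -> : z = u + (z - u) by rewrite addrC subrK.
  move: (z - u) => w; have -> : u + w - u = w by rewrite addrAC subrr add0r.
  rewrite (addrAC u) [M *m (u + w)]mulmxDr (addrAC (M *m u)).
  move: (u - z0) (M *m u - b) => s r.
  rewrite !sqr_enorm !dotp_lin -dotp_mulmx (dotpC w s) (dotpC (M *m w) r).
  by field.
- by move=> z; rewrite addr_ge0// mulr_ge0 ?sqr_ge0// divr_ge0.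
- move=> t z; rewrite -scalemxAr !enormZ !exprMn real_normK ?num_real//.
  by ring.
Qed.

End Argmin.

(** * Optimality conditions of penalized and proximal steps *)

Section ArgminCorollaries.
Context {R : realType} {d : nat}.
Implicit Types (D : set 'cV[R]_d) (h : 'cV[R]_d -> \bar R) (u z p : 'cV[R]_d).

(** In the gradient, the penalty only replaces the multiplier [lb] by [lb + sg *: (M *m u - b)];
    this makes augmented and plain Lagrangians comparable. The form of [phi] is prescribed on [D]
    only, where the indicator vanishes. *)
Lemma argmin_penalty e D h phi (k a et sg : R) (M : 'M[R]_(e, d)) b lb z0 u :
  convex_set D -> @convex_set R ('cV[R]_d * R)%type (epigraph h) ->
  (forall z, h z != -oo%E) -> 0 <= et / a -> 0 <= sg ->
  (forall z, D z -> phi z = h z + (k + dotp lb (M *m z - b)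
                                   + sg / 2 * enorm (M *m z - b) ^+ 2)%:E)%E ->
  argmin D (fun z => phi z + (et / (2 * a) * enorm (z - z0) ^+ 2)%:E)%E u <->
  subdiff D h u
    (- (M^T *m (lb + sg *: (M *m u - b)) + (et / a) *: (u - z0))).
Proof.
move=> cD ch hNy c0 sg0 phiE.
rewrite (@eq_argmin _ _ _ _ (fun z => h z + ((k - dotp lb b) +
  dotp (M^T *m lb) z + et / a / 2 * enorm (z - z0) ^+ 2 +
  sg / 2 * enorm (M *m z - b) ^+ 2)%:E)%E); last first.
  move=> z Dz; rewrite phiE// -addeA -EFinD -dotp_mulmx !dotp_lin invfM.
  by congr (_ + _%:E)%E; ring.
by rewrite argmin_quadratic// addrAC scalemxAr -mulmxDr.
Qed.

Lemma prox_subdiff D h (s : R) p z0 u :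
  convex_set D -> @convex_set R ('cV[R]_d * R)%type (epigraph h) ->
  (forall z, h z != -oo%E) -> 0 < s ->
  prox D s h (z0 - s *: p) u <-> subdiff D h u (- (p + s^-1 *: (u - z0))).
Proof.
move=> cD ch hNy s0; rewrite /prox.
(* The prox is the quadratic case with zero linear term and zero penalty; the shift of the centre by
   [s *: p], multiplied by [s^-1], puts [p] into the gradient. *)
rewrite (@eq_argmin _ _ _ _ (fun z => h z + (0 + dotp (0 : 'cV[R]_d) z +
  s^-1 / 2 * enorm (z - (z0 - s *: p)) ^+ 2 +
  0 / 2 * enorm ((0 : 'M[R]_d) *m z - 0) ^+ 2)%:E)%E); last first.
  by move=> z _; congr (_ + _%:E)%E; rewrite dotp0l invfM; ring.
rewrite argmin_quadratic// ?invr_ge0 ?ltW// scale0r addr0 add0r.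
by rewrite opprB addrCA scalerDr scalerA mulVf ?gt_eqF// scale1r.
Qed.

End ArgminCorollaries.

(** * Parameter recursions and positivity *)

Section StepSizes.
Context {R : realType} (c : params R).
Hypotheses (hc : param_system c) (mu_f_ge0 : 0 <= mu_f c).
Hypothesis mu_g_ge0 : 0 <= mu_g c.

(** Solves one backward Euler step of the flow with velocity [m - x]; [m] is 0 for [theta], [mu_f]
    for [gamma] and [mu_g] for [beta]. *)
Lemma implicit_stepE (a x x' m : R) : 0 < a ->
  (x' - x) / a = m - x' -> (1 + a) * x' = x + a * m.
Proof.
move=> a0 /(congr1 ( *%R^~ a)) /=; rewrite mulfVK ?gt_eqF//.
by move=> /(canRL (subrK x)) E; rewrite mulrDl mul1r {1}E; ring.
Qed.

Lemma theta_step k : (1 + alpha c k) * theta c k.+1 = theta c k.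
Proof.
rewrite (@implicit_stepE _ (theta c k) _ 0) ?alpha_gt0 ?mulr0 ?addr0//.
by rewrite sub0r theta_rec.
Qed.

Lemma gamma_step k :
  (1 + alpha c k) * gamma c k.+1 = gamma c k + alpha c k * mu_f c.
Proof. by apply: implicit_stepE; rewrite ?alpha_gt0 ?gamma_rec. Qed.

Lemma beta_step k :
  (1 + alpha c k) * beta c k.+1 = beta c k + alpha c k * mu_g c.
Proof. by apply: implicit_stepE; rewrite ?alpha_gt0 ?beta_rec. Qed.

Lemma theta_gt0 k : 0 < theta c k.
Proof.
elim: k => [|k IH]; first by rewrite theta_init.
by move: IH; rewrite -theta_step pmulr_rgt0// addr_gt0 ?alpha_gt0.
Qed.

Lemma gamma_gt0 k : 0 < gamma c k.
Proof.
elim: k => [|k IH]; first exact: gamma_init.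
have a0 := alpha_gt0 hc k.
rewrite -(@pmulr_rgt0 _ (1 + alpha c k)) ?addr_gt0// gamma_step.
by rewrite ltr_pwDl// mulr_ge0// ltW.
Qed.

Lemma beta_gt0 k : 0 < beta c k.
Proof.
elim: k => [|k IH]; first exact: beta_init.
have a0 := alpha_gt0 hc k.
rewrite -(@pmulr_rgt0 _ (1 + alpha c k)) ?addr_gt0// beta_step.
by rewrite ltr_pwDl// mulr_ge0// ltW.
Qed.

Lemma eta_f_gt0 k : 0 < eta_f c k.
Proof.
have a0 := alpha_gt0 hc k; have g0 := gamma_gt0 k.
by rewrite ltr_pwDl ?mulr_gt0 ?addr_gt0// mulr_ge0// ltW.
Qed.

Lemma eta_g_gt0 k : 0 < eta_g c k.
Proof.
have a0 := alpha_gt0 hc k; have g0 := beta_gt0 k.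
by rewrite ltr_pwDl ?mulr_gt0 ?addr_gt0// mulr_ge0// ltW.
Qed.

End StepSizes.

(** * Finiteness and block minimization of the Lagrangian *)

Section Lagrangian.
Context {R : realType} {m n r : nat} (P : problem R m n r).
Hypothesis hP : convex_problem P.
Implicit Types (x : 'cV[R]_m) (y : 'cV[R]_n) (lam : 'cV[R]_r).

Lemma pf_neqNy x : pf P x != -oo%E.
Proof. by case: hP => _ _ [[]]. Qed.

Lemma pg_neqNy y : pg P y != -oo%E.
Proof. by case: hP => _ _ _ [[]]. Qed.

Lemma lagrE x y lam : pX P x -> pY P y ->
  lagr P x y lam = (objective P x y + (dotp lam (residual P x y))%:E)%E.
Proof. by move=> Xx Yy; rewrite /lagr /indicator mem_set// adde0. Qed.

(** Membership in an [argmin] supplies a value below [+oo]. As neither function takes the value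
    [-oo], no summand can then be infinite; [a] stands for the proximal term. *)
Lemma lagr_fin x y lam (a : R) : (lagr P x y lam + a%:E < +oo)%E ->
  [/\ pX P x, pY P y, pf P x \is a fin_num & pg P y \is a fin_num].
Proof.
have := pf_neqNy x; have := pg_neqNy y.
rewrite /lagr /objective /indicator.
case: ifPn => [/set_mem[Xx Yy]|_];
  by case: (pf P x) (pg P y) => [f| |] [g| |].
Qed.

(** Lets the statements on augmented Lagrangians cover the steps of (G) too. *)
Lemma aug_lagr0 x y lam : aug_lagr P 0 x y lam = lagr P x y lam.
Proof. by rewrite /aug_lagr !mul0r adde0. Qed.

Lemma argmin_aug_lagr_x (a et sg : R) y lam z0 u :
  pY P y -> pg P y \is a fin_num -> 0 <= et / a -> 0 <= sg ->
  argmin (pX P) (fun z => aug_lagr P sg z y lam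
    + (et / (2 * a) * enorm (z - z0) ^+ 2)%:E)%E u <->
  subdiff (pX P) (pf P) u
    (- ((pA P)^T *m (lam + sg *: residual P u y) + (et / a) *: (u - z0))).
Proof.
move=> Yy gy et0 sg0; case: hP => -[_ cX] _ [[_ _] _ cf] _.
have resE z : residual P z y = pA P *m z - (pb P - pB P *m y).
  by rewrite /residual opprB addrA.
rewrite resE; apply: (@argmin_penalty _ _ _ _ _ _ (fine (pg P y))) => //.
  exact: pf_neqNy.
move=> z Xz; rewrite /aug_lagr lagrE// /objective -resE -{1}(fineK gy).
by rewrite -!addeA -!EFinD addrA.
Qed.

Lemma argmin_aug_lagr_y (a et sg : R) x lam z0 u :
  pX P x -> pf P x \is a fin_num -> 0 <= et / a -> 0 <= sg ->
  argmin (pY P) (fun z => aug_lagr P sg x z lam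
    + (et / (2 * a) * enorm (z - z0) ^+ 2)%:E)%E u <->
  subdiff (pY P) (pg P) u
    (- ((pB P)^T *m (lam + sg *: residual P x u) + (et / a) *: (u - z0))).
Proof.
move=> Xx fx et0 sg0; case: hP => _ [_ cY] _ [[_ _] _ cg].
have resE z : residual P x z = pB P *m z - (pb P - pA P *m x).
  by rewrite /residual opprB addrA (addrC (pB P *m z)).
rewrite resE; apply: (@argmin_penalty _ _ _ _ _ _ (fine (pf P x))) => //.
  exact: pg_neqNy.
move=> z Yz; rewrite /aug_lagr lagrE// /objective -resE -{1}(fineK fx).
by rewrite (addeC _ (pg P z)) -!addeA -!EFinD addrA.
Qed.

End Lagrangian.

(** * Equivalence of scheme (G) and the algorithm *)

Section Schemes.
Context {R : realType} {m n r : nat} (P : problem R m n r) (c : params R).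
Context (s : iterates R m n r) (lbar : nat -> 'cV[R]_r).
Hypotheses (hP : convex_problem P) (hc : param_system c).
Hypotheses (mu_f_ge0 : 0 <= mu_f c) (mu_g_ge0 : 0 <= mu_g c).

Let x := it_x s.
Let v := it_v s.
Let y := it_y s.
Let w := it_w s.
Let lam := it_lam s.
Let al := alpha c.
Let th := theta c.

(** The condition shared by both forms of the x-step; each form is proved equivalent to it. *)
Definition optimal_x k : Prop :=
  subdiff (pX P) (pf P) (x k.+1)
    (- ((pA P)^T *m lbar k.+1
        + (eta_f c k / al k ^+ 2) *: (x k.+1 - x_tilde c s k))).

Definition optimal_y k : Prop :=
  subdiff (pY P) (pg P) (y k.+1)
    (- ((pB P)^T *m lbar k.+1
        + (eta_g c k / al k ^+ 2) *: (y k.+1 - y_tilde c s k))).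

Lemma eta_f_ratio_gt0 k : 0 < eta_f c k / al k ^+ 2.
Proof. by rewrite divr_gt0 ?eta_f_gt0// exprn_gt0 ?alpha_gt0. Qed.

Lemma eta_g_ratio_gt0 k : 0 < eta_g c k / al k ^+ 2.
Proof. by rewrite divr_gt0 ?eta_g_gt0// exprn_gt0 ?alpha_gt0. Qed.

Lemma G_x_optimal k : pY P (y k.+1) -> pg P (y k.+1) \is a fin_num ->
  argmin (pX P) (fun u => (lagr P u (y k.+1) (lbar k.+1)
    + (eta_f c k / (2 * al k ^+ 2) * enorm (u - x_tilde c s k) ^+ 2)%:E)%E)
    (x k.+1) <-> optimal_x k.
Proof.
move=> Yy gy; under [X in argmin _ X]eq_fun do rewrite -aug_lagr0.
rewrite argmin_aug_lagr_x ?scale0r ?addr0//.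
exact/ltW/eta_f_ratio_gt0.
Qed.

Lemma G_y_optimal k : pX P (x k.+1) -> pf P (x k.+1) \is a fin_num ->
  argmin (pY P) (fun u => (lagr P (x k.+1) u (lbar k.+1)
    + (eta_g c k / (2 * al k ^+ 2) * enorm (u - y_tilde c s k) ^+ 2)%:E)%E)
    (y k.+1) <-> optimal_y k.
Proof.
move=> Xx fx; under [X in argmin _ X]eq_fun do rewrite -aug_lagr0.
rewrite argmin_aug_lagr_y ?scale0r ?addr0//.
exact/ltW/eta_g_ratio_gt0.
Qed.

Lemma prox_optimal k : let s_k := al k ^+ 2 / eta_f c k in
  prox (pX P) s_k (pf P) (x_tilde c s k - s_k *: ((pA P)^T *m lbar k.+1))
    (x k.+1) <-> optimal_x k.
Proof.
case: hP => -[_ cX] _ [_ _ cf] _ s_k.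
rewrite prox_subdiff ?invf_div//; first exact: pf_neqNy.
by rewrite /s_k -invf_div invr_gt0 eta_f_ratio_gt0.
Qed.

(** After substituting [w k.+1], the coefficient of [B y_{k+1}] in [lbar k.+1] is
    [(1 + al k) / th k], which equals [(th k.+1)^-1]. Hence the penalty parameter [sigma_k], and
    [lam_hat] collects the terms free of [y k.+1]. *)
Lemma lbar_lam_hat k : w k.+1 = y k.+1 + (al k)^-1 *: (y k.+1 - y k) ->
  lbar_choice P c s lbar ->
  lbar k.+1 = lam_hat P c s k + (th k.+1)^-1 *: residual P (x k) (y k.+1).
Proof.
move=> wE ->; rewrite -/w -/al wE.
have a0 := alpha_gt0 hc k; have t0 := theta_gt0 hc k.+1.
have tE := theta_step hc k; rewrite -/al in tE.
rewrite /lam_hat /residual -/x -/y -/v -/th -/al -/lam -[th k]tE.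
rewrite !mulmxBr mulmxDr -scalemxAr mulmxBr.
move: (pA P *m x k) (pA P *m v k) (pB P *m y k) (pB P *m y k.+1) => X V Y Y1.
apply/colP => i; rewrite !mxE -/th.
have : 1 + al k != 0 by rewrite gt_eqF// addr_gt0.
by move: a0 t0 => /lt0r_neq0 a0 /lt0r_neq0 t0 a10; field; rewrite a0 t0 a10.
Qed.

Lemma alg_y_optimal k : w k.+1 = y k.+1 + (al k)^-1 *: (y k.+1 - y k) ->
  lbar_choice P c s lbar ->
  pX P (x k) -> pf P (x k) \is a fin_num ->
  argmin (pY P) (fun u => (aug_lagr P (th k.+1)^-1 (x k) u (lam_hat P c s k)
      + (eta_g c k / (2 * al k ^+ 2) * enorm (u - y_tilde c s k) ^+ 2)%:E)%E)
    (y k.+1) <-> optimal_y k.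
Proof.
move=> wE lbarE Xx fx; rewrite argmin_aug_lagr_y//.
- by rewrite -lbar_lam_hat.
- exact/ltW/eta_g_ratio_gt0.
- by rewrite invr_ge0 ltW// theta_gt0.
Qed.

Lemma scheme_G_algorithm : pX P (x 0) -> (pf P (x 0) < +oo)%E ->
  scheme_G P c s lbar /\ lbar_choice P c s lbar <-> algorithm P c s lbar.
Proof.
move=> X0 f0.
(* The first y-step of the algorithm evaluates the Lagrangian at [x 0], whereas (G) evaluates it
   only at later iterates. *)
have x0_fin : pX P (x 0) /\ pf P (x 0) \is a fin_num.
  by split=> //; rewrite fin_numE pf_neqNy//=; apply: contraTneq f0 => ->.
split.
  move=> [[Gv Gx Glam Gy Gw] lbarE].
  have fin k : [/\ pX P (x k.+1), pY P (y k.+1), pf P (x k.+1) \is a fin_num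
      & pg P (y k.+1) \is a fin_num].
    by case: (Gx k) => _ + _; apply: lagr_fin.
  have x_fin k : pX P (x k) /\ pf P (x k) \is a fin_num.
    by case: k => [//|k]; case: (fin k).
  split=> // k.
  - have [Xk fk] := x_fin k; apply/(alg_y_optimal (Gw k) lbarE Xk fk).
    by have [Xk1 _ fk1 _] := fin k; apply/(G_y_optimal Xk1 fk1)/Gy.
  - apply/prox_optimal.
    by have [_ Yk1 _ gk1] := fin k; apply/(G_x_optimal Yk1 gk1)/Gx.
move=> [Ay Aw lbarE Ax Av Alam]; split=> //.
(* The x-steps come first: they make [f] finite at all later [x k], which the conversion of the
   y-steps requires. *)
have ox k : optimal_x k by apply/prox_optimal/Ax.
have x_fin k : pX P (x k) /\ pf P (x k) \is a fin_num.
  by case: k => [//|k]; case: (ox k).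
have oy k : optimal_y k.
  by have [Xk fk] := x_fin k; apply/(alg_y_optimal (Aw k) lbarE Xk fk)/Ay.
split=> // k.
- by have [Yk gk _] := oy k; apply/(G_x_optimal Yk gk).
- by have [Xk fk _] := ox k; apply/(G_y_optimal Xk fk).
Qed.

End Schemes.

(** Descent of one block, used for both [(x, v)] and [(y, w)]; [q] is the transposed constraint
    matrix applied to [lbar k.+1]. The kept term in [v' - v] later pays for the multiplier error. *)
Lemma proximal_block_step (R : realType) d (D : set 'cV[R]_d) h
    (mu a gam gam' eta : R) (x x' v v' xs q : 'cV[R]_d) :
  0 < a -> 0 <= mu -> 0 < eta -> eta = (a + 1) * gam + mu * a ->
  (1 + a) * gam' = gam + a * mu -> v' = x' + a^-1 *: (x' - x) ->
  strongly_convex_on D mu h ->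
  subdiff D h x' (- (q + (eta / a ^+ 2) *:
    (x' - (x + (a * gam / eta) *: (v - x))))) ->
  D x -> h x \is a fin_num -> D xs -> h xs \is a fin_num ->
  (1 + a) * (fine (h x') - fine (h xs) + gam' / 2 * enorm (v' - xs) ^+ 2) <=
  fine (h x) - fine (h xs) + gam / 2 * enorm (v - xs) ^+ 2
  - a * dotp q (v' - xs) - gam / 2 * enorm (v' - v) ^+ 2.
Proof.
move=> a0 mu0 eta0 etaE gamE v'E sc sub Dx hx Dxs hxs.
have [Dx' hx' subz] := sub.
have {gamE} -> : gam' = (gam + a * mu) / (1 + a).
  by rewrite -gamE mulrC mulKf// gt_eqF// addr_gt0.
have aN0 := lt0r_neq0 a0.
have {}v'E : x = x' - a *: (v' - x').
  by rewrite v'E addrAC subrr add0r scalerA mulfV// scale1r opprB addrC subrK.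
have [G gamE] : exists G, gam = a * G.
  by exists (gam / a); rewrite mulrC mulfVK.
subst gam.
(* The extrapolated centre and [eta] are designed so that the proximal residual becomes a
   combination of the velocity increment and [v' - x']. *)
have pE : (eta / a ^+ 2) *: (x' - (x + (a * (a * G) / eta) *: (v - x))) =
    G *: (v' - v) + mu *: (v' - x').
  rewrite v'E; apply/colP => i; rewrite !mxE etaE.
  by field; rewrite aN0 -etaE gt_eqF.
rewrite pE in sub subz.
move: (sc xs x' _ Dxs Dx' sub) (subz x Dx).
rewrite -(fineK hx) -(fineK hx') -(fineK hxs) -!(EFinB, EFinD).
rewrite !lee_fin {sub subz pE} /=.
have -> : xs - x' = (v' - x') - (v' - xs).
  by rewrite opprB [RHS]addrC addrA subrK.
have -> : x - x' = - (a *: (v' - x')) by rewrite v'E addrAC subrr add0r.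
have -> : v - xs = (v' - xs) - (v' - v) by rewrite opprB [RHS]addrC addrA subrK.
move: (v' - x') (v' - xs) (v' - v) (fine _) (fine _) (fine _).
move=> t s e f f' fs.
rewrite !sqr_enorm !dotp_lin (dotpC s t) (dotpC s e).
have : 0 <= a * mu * dotp t t by rewrite !mulr_ge0 ?dotp_ge0// ltW.
move: (dotp t t) (dotp t s) (dotp s s) (dotp q t) (dotp q s).
move: (dotp e t) (dotp e s) (dotp e e) => et es ee tt ts ss qt qs tt0.
(* Strong convexity at [xs] is taken with weight [a] and the subgradient inequality at [x] with
   weight 1, which produces [(1 + a) * f']. *)
move=> /(ler_wpM2l (ltW a0)) /= scaled_sc sub_x.
have -> : (1 + a) * (f' - fs + (a * G + a * mu) / (1 + a) / 2 * ss) =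
    (1 + a) * (f' - fs) + (a * G + a * mu) / 2 * ss.
  by field; rewrite gt_eqF// addr_gt0.
lra.
Qed.

(** * Decay rates of [theta], with [N] in the role of the norm of [A] *)

Section ThetaRate.
Context {R : realType} (c : params R) (N : R).
Hypotheses (hc : param_system c) (mu_f_ge0 : 0 <= mu_f c) (N_ge0 : 0 <= N).
Hypothesis gamma0E : 0 < mu_f c -> gamma c 0 = mu_f c.
Hypothesis stepE : forall k, alpha c k ^+ 2 * N ^+ 2 = gamma c k * theta c k.

Let al := alpha c.
Let th := theta c.
Let a := Num.sqrt (gamma c 0).
Let Q := N + a.

(** If [N] were 0, the step-size rule would equate 0 with a positive product. *)
Lemma rate_N_gt0 : 0 < N.
Proof.
rewrite lt_neqAle N_ge0 andbT eq_sym; apply/negP => /eqP N0.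
have := stepE 0; rewrite N0 expr0n mulr0 => /esym/eqP.
by rewrite gt_eqF// mulr_gt0 ?gamma_gt0 ?theta_gt0.
Qed.

Lemma rate_a_gt0 : 0 < a.
Proof. by rewrite sqrtr_gt0 gamma_init. Qed.

Lemma rate_Q_gt0 : 0 < Q.
Proof. by rewrite addr_gt0 ?rate_N_gt0 ?rate_a_gt0. Qed.

Lemma invr_theta_step k : (th k.+1)^-1 = (1 + al k) * (th k)^-1.
Proof.
rewrite /th -(theta_step hc k) invfM mulrA mulfV ?mul1r//.
by rewrite gt_eqF// addr_gt0 ?alpha_gt0.
Qed.

(** Both sides are divided by [1 + al k] at each step, but [gamma] first gains [al k * mu_f c]. *)
Lemma gamma_ge_theta k : gamma c 0 * th k <= gamma c k.
Proof.
elim: k => [|k IH]; first by rewrite /th theta_init// mulr1.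
have a0 := alpha_gt0 hc k.
rewrite -(@ler_pM2l _ (1 + al k)) ?addr_gt0// mulrCA theta_step//.
by rewrite gamma_step// (le_trans IH)// lerDl mulr_ge0// ltW.
Qed.

Lemma gamma_const k : 0 < mu_f c -> gamma c k = mu_f c.
Proof.
move=> mu0; elim: k => [|k IH]; first exact: gamma0E.
have a0 : 1 + al k != 0 by rewrite gt_eqF// addr_gt0 ?alpha_gt0.
by apply: (mulfI a0); rewrite gamma_step// IH mulrDl mul1r.
Qed.

Lemma alpha_invr_theta_ge k : a <= al k * N * (th k)^-1.
Proof.
have t0 : 0 < th k by rewrite theta_gt0.
have al0 : 0 < al k by rewrite alpha_gt0.
rewrite ler_pdivlMr// -ler_sqr ?nnegrE
  ?(mulr_ge0, sqrtr_ge0, ltW al0, ltW t0)//.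
rewrite !exprMn stepE sqr_sqrtr ?(ltW (gamma_init hc))//.
by rewrite expr2 mulrA ler_pM2r// gamma_ge_theta.
Qed.

(** [Q / th k] grows at each step by [al k * Q / th k], at least [al k * N / th k], which the
    step-size rule bounds below by [a]. *)
Lemma invr_theta_ge k : Q + a * k%:R <= Q * (th k)^-1.
Proof.
elim: k => [|k IH]; first by rewrite /th theta_init// mulr0 addr0 invr1 mulr1.
rewrite invr_theta_step -natr1.
have -> : Q * ((1 + al k) * (th k)^-1) =
    Q * (th k)^-1 + al k * Q * (th k)^-1 by ring.
rewrite mulrDr mulr1 addrA lerD// (le_trans (alpha_invr_theta_ge k))//.
rewrite ler_pM2r ?invr_gt0 ?theta_gt0//.
by rewrite ler_wpM2l ?lerDl ?sqrtr_ge0 ?(ltW (alpha_gt0 hc k)).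
Qed.

Lemma theta_le_linear k : th k <= Q / (Q + a * k%:R).
Proof.
rewrite ler_pdivlMr; last first.
  by rewrite ltr_pwDl ?rate_Q_gt0// mulr_ge0 ?sqrtr_ge0.
by rewrite mulrC -ler_pdivlMr ?theta_gt0// invr_theta_ge.
Qed.

Lemma invr_theta_ge1 k : 1 <= (th k)^-1.
Proof.
rewrite -(ler_pM2l rate_Q_gt0) mulr1 (le_trans _ (invr_theta_ge k))//.
by rewrite lerDl mulr_ge0 ?sqrtr_ge0.
Qed.

(** For [mu_f c = 0] this is [theta <= 1]. Otherwise [gamma] is constant, and [2 * Q * tau], with
    [tau] the inverse square root of [theta], grows by at least [b] per step. *)
Lemma sqrtr_invr_theta_ge k :
  2 * Q + Num.sqrt (mu_f c) * k%:R <= 2 * Q * Num.sqrt (th k)^-1.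
Proof.
set b := Num.sqrt (mu_f c).
have Q0 := rate_Q_gt0; have N0 := rate_N_gt0.
have T1 j : 1 <= Num.sqrt (th j)^-1.
  by rewrite -[leLHS]sqrtr1 ler_wsqrtr ?invr_theta_ge1.
have [mu0|mu0] := eqVneq (mu_f c) 0.
  by rewrite /b mu0 sqrtr0 mul0r addr0 ler_peMr ?T1// mulr_ge0 ?(ltW Q0).
have mup : 0 < mu_f c by rewrite lt_neqAle eq_sym mu0.
have ab : a = b by rewrite /a /b gamma0E.
elim: k => [|k IH].
  by rewrite mulr0 addr0 ler_peMr ?T1// mulr_ge0 ?(ltW Q0).
have t0 : 0 < th k by rewrite theta_gt0.
have al0 : 0 < al k by rewrite alpha_gt0.
rewrite -[k.+1%:R]natr1 [b * _]mulrDr mulr1 addrA.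
rewrite (le_trans (lerD IH (lexx b)))//.
have tau1 := T1 k; set tau := Num.sqrt (th k)^-1 in tau1 *.
have tau2 : tau ^+ 2 = (th k)^-1 by rewrite sqr_sqrtr// invr_ge0 ltW.
(* The step-size rule with [gamma] equal to [mu_f], after taking square roots. *)
have bE : b = al k * N * tau.
  apply/eqP; rewrite -(@eqrXn2 _ 2) ?sqrtr_ge0//; last first.
    by rewrite !mulr_ge0 ?sqrtr_ge0// ltW.
  rewrite !exprMn stepE gamma_const// tau2 mulfK ?(gt_eqF t0)//.
  by rewrite [b ^+ 2]sqr_sqrtr// ltW.
rewrite -ler_sqr ?nnegrE; last 2 first.
- by rewrite addr_ge0 ?sqrtr_ge0// !mulr_ge0 ?sqrtr_ge0// ltW.
- by rewrite !mulr_ge0 ?sqrtr_ge0// ltW.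
rewrite [leRHS]exprMn sqr_sqrtr; last by rewrite invr_ge0 ltW// theta_gt0.
rewrite invr_theta_step -tau2.
have key : b * b <= 4 * Q * (al k * tau ^+ 2) * b.
  rewrite ler_wpM2r ?sqrtr_ge0// [in leLHS]bE.
  have NQ : N <= 4 * Q * tau.
    have NleQ : N <= Q by rewrite lerDl sqrtr_ge0.
    by have := ler_wpM2l (ltW Q0) tau1; lra.
  have := ler_wpM2l (mulr_ge0 (ltW al0) (sqrtr_ge0 (th k)^-1)) NQ.
  by rewrite -/tau; lra.
have QN : b = Q - N by rewrite /Q addrAC subrr add0r ab.
(* Splitting [Q] as [(Q - N) + N] matches the square of [2 * Q * tau + b]: the [N] part is its cross
   term by [bE], and the [Q - N = b] part dominates [b ^+ 2] by [key]. *)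
have -> : (2 * Q) ^+ 2 * ((1 + al k) * tau ^+ 2) =
    (2 * Q * tau) ^+ 2 + 4 * Q * (al k * tau ^+ 2) * (Q - N)
    + 4 * Q * tau * (al k * N * tau) by ring.
by rewrite -QN -bE; nra.
Qed.

Lemma theta_le_quadratic k :
  th k <= 4 * Q ^+ 2 / (2 * Q + Num.sqrt (mu_f c) * k%:R) ^+ 2.
Proof.
have Q0 := rate_Q_gt0; have t0 : 0 < th k by rewrite theta_gt0.
have b0 : 0 < 2 * Q + Num.sqrt (mu_f c) * k%:R.
  by rewrite ltr_pwDl ?mulr_gt0// mulr_ge0 ?sqrtr_ge0.
rewrite ler_pdivlMr ?exprn_gt0// mulrC -ler_pdivlMr//.
have := sqrtr_invr_theta_ge k.
rewrite -ler_sqr ?nnegrE ?(ltW b0) ?mulr_ge0 ?sqrtr_ge0 ?(ltW Q0)//.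
by rewrite [leRHS]exprMn sqr_sqrtr ?invr_ge0 ?(ltW t0)// exprMn -natrX.
Qed.

End ThetaRate.

(** * Feasibility and finiteness at the saddle point *)

Section Saddle.
Context {R : realType} {m n r : nat} (P : problem R m n r).
Context (xs : 'cV[R]_m) (ys : 'cV[R]_n) (lams : 'cV[R]_r).
Hypotheses (hP : convex_problem P) (hsaddle : saddle_point P xs ys lams).
Hypothesis hFs : (objective P xs ys < +oo)%E.

Lemma saddle_fin : pf P xs \is a fin_num /\ pg P ys \is a fin_num.
Proof.
move: hFs (pf_neqNy hP xs) (pg_neqNy hP ys); rewrite /objective.
by case: (pf P xs) (pg P ys) => [f| |] [g| |].
Qed.

Lemma saddle_objective_fin : objective P xs ys \is a fin_num.
Proof. by case: saddle_fin => f_fin g_fin; rewrite fin_numD f_fin. Qed.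

(** Testing the saddle inequality at [lams] plus the residual makes the squared residual norm
    nonpositive. *)
Lemma saddle_residual : residual P xs ys = 0.
Proof.
case: hsaddle => Xx Yy /(_ (lams + residual P xs ys)) + _.
rewrite !lagrE// -(fineK saddle_objective_fin) -!EFinD lee_fin lerD2l.
rewrite dotpDl gerDl => le0; apply/eqP.
by rewrite -dotp_eq0 eq_le le0 dotp_ge0.
Qed.

Lemma lagr_saddle lam : lagr P xs ys lam = objective P xs ys.
Proof.
by case: hsaddle => Xx Yy _ _; rewrite lagrE// saddle_residual dotp0r adde0.
Qed.

End Saddle.

(** With [l = lam k - lams], [z] the residual at the new velocities and [e = v k.+1 - v k], the
    second factor is [lbar k.+1 - lams]. Completing the square leaves [- a ^+ 2 / (2 * t)] times the
    squared norm of [z - M *m e], plus the same coefficient, with positive sign, times that of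
    [M *m e]; the step-size rule bounds the latter by the [e] term. *)
Lemma multiplier_quadratic_le (R : realType) (m r : nat) (a t g : R)
    (M : 'M[R]_(r, m)) (l z : 'cV[R]_r) (e : 'cV[R]_m) :
  0 < a -> 0 < t -> a ^+ 2 * opnorm M ^+ 2 = g * t ->
  t / 2 * enorm (l + (a / t) *: z) ^+ 2
    - a * dotp (l + (a / t) *: (z - M *m e)) z - g / 2 * enorm e ^+ 2 <=
  t / 2 * enorm l ^+ 2.
Proof.
move=> a0 t0 gE.
have Me : enorm (M *m e) ^+ 2 <= opnorm M ^+ 2 * enorm e ^+ 2.
  rewrite -exprMn ler_sqr ?nnegrE ?enorm_ge0 ?enorm_mulmx_le//.
  by rewrite mulr_ge0 ?opnorm_ge0 ?enorm_ge0.
have k0 : 0 <= a ^+ 2 / t / 2 by rewrite !divr_ge0 ?sqr_ge0 ?(ltW t0).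
have : 0 <= a ^+ 2 / t / 2 * enorm (z - M *m e) ^+ 2.
  by rewrite mulr_ge0 ?sqr_ge0.
have : a ^+ 2 / t / 2 * enorm (M *m e) ^+ 2 <= g / 2 * enorm e ^+ 2.
  rewrite (le_trans (ler_wpM2l k0 Me))// mulrA.
  rewrite (_ : _ * opnorm M ^+ 2 = a ^+ 2 * opnorm M ^+ 2 / t / 2);
    last by ring.
  by rewrite gE mulfK ?(gt_eqF t0).
rewrite !sqr_enorm; move: (M *m e) (dotp e e) => u ee.
rewrite !dotp_lin (dotpC u z) (dotpC z l).
have [b bE] : exists b, a = t * b.
  by exists (a / t); rewrite mulrC mulfVK ?(gt_eqF t0).
rewrite bE exprMn [t * b / t]mulrAC mulfV ?(gt_eqF t0)// mul1r.
have -> : t ^+ 2 * b ^+ 2 / t = t * b ^+ 2.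
  by field; rewrite gt_eqF.
lra.
Qed.

(** * Lyapunov decay and its consequences along the algorithm *)

Section Decay.
Context {R : realType} {m n r : nat} (P : problem R m n r) (c : params R).
Context (s : iterates R m n r) (lbar : nat -> 'cV[R]_r).
Context (xs : 'cV[R]_m) (ys : 'cV[R]_n) (lams : 'cV[R]_r).
Hypotheses (hP : convex_problem P) (hsaddle : saddle_point P xs ys lams).
Hypothesis hFs : (objective P xs ys < +oo)%E.
Hypotheses (hc : param_system c) (mu_f_ge0 : 0 <= mu_f c).
Hypothesis mu_g_ge0 : 0 <= mu_g c.
Hypothesis f_sc : strongly_convex_on (pX P) (mu_f c) (pf P).
Hypothesis g_sc : strongly_convex_on (pY P) (mu_g c) (pg P).
Hypothesis stepE : forall k,
  alpha c k ^+ 2 * opnorm (pA P) ^+ 2 = gamma c k * theta c k.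
Hypothesis halg : algorithm P c s lbar.

Let x := it_x s.
Let v := it_v s.
Let y := it_y s.
Let w := it_w s.
Let lam := it_lam s.
Let al := alpha c.
Let th := theta c.

Hypotheses (x0_fin : pX P (x 0) /\ pf P (x 0) \is a fin_num).
Hypotheses (y0_fin : pY P (y 0) /\ pg P (y 0) \is a fin_num).

Let res k := residual P (x k) (y k).

(** Real-valued form of the Lagrangian gap: feasibility of the saddle point turns its second
    Lagrangian into the optimal value. [fine] loses nothing, since all values involved are
    finite. *)
Definition gap k : R :=
  fine (pf P (x k)) - fine (pf P xs) + (fine (pg P (y k)) - fine (pg P ys))
  + dotp lams (res k).

Definition energy k : R :=
  gap k + (gamma c k / 2 * enorm (v k - xs) ^+ 2
    + beta c k / 2 * enorm (w k - ys) ^+ 2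
    + th k / 2 * enorm (lam k - lams) ^+ 2).

Lemma alg_optimal_x k : optimal_x P c s lbar k.
Proof. by apply/prox_optimal => //; case: halg. Qed.

Lemma iter_x_fin k : pX P (x k) /\ pf P (x k) \is a fin_num.
Proof. by case: k => [//|k]; case: (alg_optimal_x k). Qed.

Lemma alg_optimal_y k : optimal_y P c s lbar k.
Proof.
case: halg => Ay Aw lbarE _ _ _; have [Xk fk] := iter_x_fin k.
exact/(alg_y_optimal hP hc mu_g_ge0 (Aw k) lbarE Xk fk)/Ay.
Qed.

Lemma iter_y_fin k : pY P (y k) /\ pg P (y k) \is a fin_num.
Proof. by case: k => [//|k]; case: (alg_optimal_y k). Qed.

Lemma objective_gapE k :
  (objective P (x k) (y k) - objective P xs ys)%E =
  (gap k - dotp lams (res k))%:E.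
Proof.
have [_ fk] := iter_x_fin k; have [_ gk] := iter_y_fin k.
have [fs gs] := saddle_fin hP hFs.
rewrite /objective /gap addrK -(fineK fk) -(fineK gk) -(fineK fs) -(fineK gs).
by rewrite -!(EFinB, EFinD); congr _%:E => /=; ring.
Qed.

Lemma lagr_gapE k :
  (lagr P (x k) (y k) lams - lagr P xs ys (lam k))%E = (gap k)%:E.
Proof.
have [Xk fk] := iter_x_fin k; have [Yk gk] := iter_y_fin k.
rewrite lagrE// (lagr_saddle hP hsaddle hFs) addeAC objective_gapE.
by rewrite -EFinD subrK.
Qed.

Lemma lyapunovE k : lyapunov P c s xs ys lams k = (energy k)%:E.
Proof. by rewrite /lyapunov lagr_gapE. Qed.

Lemma gap_ge0 k : 0 <= gap k.
Proof.
rewrite -lee_fin -lagr_gapE sube_ge0; last first.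
  by rewrite (lagr_saddle hP hsaddle hFs) saddle_objective_fin ?orbT.
rewrite (lagr_saddle hP hsaddle hFs) -(lagr_saddle hP hsaddle hFs lams).
by case: hsaddle.
Qed.

Lemma energy_step k : (1 + al k) * energy k.+1 <= energy k.
Proof.
case: halg => _ Aw lbarE _ Av Alam.
have a0 := alpha_gt0 hc k; have t0 := theta_gt0 hc k.
have [Xk fk] := iter_x_fin k; have [Yk gk] := iter_y_fin k.
have [fs gs] := saddle_fin hP hFs; have [Xs Ys _ _] := hsaddle.
have Hf := proximal_block_step a0 mu_f_ge0 (eta_f_gt0 hc mu_f_ge0 k) erefl
  (gamma_step hc k) (Av k) f_sc (alg_optimal_x k) Xk fk Xs fs.
have Hg := proximal_block_step a0 mu_g_ge0 (eta_g_gt0 hc mu_g_ge0 k) erefl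
  (beta_step hc k) (Aw k) g_sc (alg_optimal_y k) Yk gk Ys gs.
pose z : 'cV[R]_r := pA P *m v k.+1 + pB P *m w k.+1 - pb P.
have zE : z = pA P *m (v k.+1 - xs) + pB P *m (w k.+1 - ys).
  rewrite /z !mulmxBr addrACA -opprD.
  by have /eqP := saddle_residual hP hsaddle hFs; rewrite subr_eq0 => /eqP ->.
(* The velocities extrapolate the iterates, so the residual at the velocities is a discrete
   derivative of [res]; paired with [lams], it handles the linear part of the gap. *)
have z_res : al k *: z = (1 + al k) *: res k.+1 - res k.
  rewrite /z [v k.+1](Av k) [w k.+1](Aw k) /res /residual.
  rewrite !mulmxDr -!scalemxAr !mulmxBr -/x -/y -/al.
  move: (pA P *m x k.+1) (pA P *m x k) (pB P *m y k.+1) (pB P *m y k).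
  move=> X1 X0 Y1 Y0; apply/colP => i; rewrite !mxE.
  by field; rewrite gt_eqF.
have lbE : lbar k.+1 = lam k + (al k / th k) *: (z - pA P *m (v k.+1 - v k)).
  rewrite lbarE; congr (_ + _ *: _); rewrite /z mulmxBr opprB.
  move: (pA P *m v k) (pA P *m v k.+1) => V V1.
  by apply/colP => i; rewrite !mxE; ring.
have lamE : lam k.+1 - lams = (lam k - lams) + (al k / th k) *: z.
  by rewrite [lam k.+1]Alam addrAC.
have lams_res : (1 + al k) * dotp lams (res k.+1) =
    dotp lams (res k) + al k * dotp lams z.
  rewrite -[al k * _]dotpZr z_res; move: (res k.+1) (res k) => r1 r0.
  by rewrite !dotp_lin; ring.
have := multiplier_quadratic_le (lam k - lams) z (v k.+1 - v k) a0 t0 (stepE k).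
rewrite -lamE; move: Hf Hg; rewrite -!dotp_mulmx.
have -> : dotp (lam k - lams + (alpha c k / theta c k) *:
    (z - pA P *m (v k.+1 - v k))) z = dotp (lbar k.+1) z - dotp lams z.
  by rewrite addrAC -lbE dotpDl dotpNl.
have -> : dotp (lbar k.+1) z =
    dotp (lbar k.+1) (pA P *m (v k.+1 - xs))
    + dotp (lbar k.+1) (pB P *m (w k.+1 - ys)) by rewrite zE dotpDr.
(* The increment term of the y-block is simply dropped; that of the x-block is spent on the
   multiplier error. *)
have : 0 <= beta c k / 2 * enorm (w k.+1 - w k) ^+ 2.
  by rewrite mulr_ge0 ?sqr_ge0// divr_ge0// ltW// beta_gt0.
rewrite /energy /gap.
have -> : (1 + al k) * (fine (pf P (x k.+1)) - fine (pf P xs) +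
    (fine (pg P (y k.+1)) - fine (pg P ys)) + dotp lams (res k.+1) +
    (gamma c k.+1 / 2 * enorm (v k.+1 - xs) ^+ 2 +
     beta c k.+1 / 2 * enorm (w k.+1 - ys) ^+ 2 +
     th k.+1 / 2 * enorm (lam k.+1 - lams) ^+ 2)) =
  (1 + al k) * (fine (pf P (x k.+1)) - fine (pf P xs)
    + gamma c k.+1 / 2 * enorm (v k.+1 - xs) ^+ 2)
  + (1 + al k) * (fine (pg P (y k.+1)) - fine (pg P ys)
    + beta c k.+1 / 2 * enorm (w k.+1 - ys) ^+ 2)
  + (1 + al k) * dotp lams (res k.+1)
  + (1 + al k) * th k.+1 / 2 * enorm (lam k.+1 - lams) ^+ 2 by ring.
rewrite lams_res /th /al (theta_step hc k) -/x -/y -/v -/w -/lam.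
lra.
Qed.

Lemma energy_le k : energy k <= th k * energy 0.
Proof.
elim: k => [|k IH]; first by rewrite /th theta_init// mul1r.
have a0 : 0 < 1 + al k by rewrite addr_gt0 ?alpha_gt0.
rewrite -(ler_pM2l a0) mulrA theta_step//.
exact: le_trans (energy_step k) IH.
Qed.

Lemma quad_terms_ge0 k : 0 <= gamma c k / 2 * enorm (v k - xs) ^+ 2
    + beta c k / 2 * enorm (w k - ys) ^+ 2.
Proof.
by rewrite addr_ge0// mulr_ge0 ?sqr_ge0// divr_ge0// ltW ?gamma_gt0 ?beta_gt0.
Qed.

Lemma gap_le k : gap k <= th k * energy 0.
Proof.
apply: le_trans (energy_le k); rewrite lerDl addr_ge0 ?quad_terms_ge0//.
by rewrite mulr_ge0 ?sqr_ge0// divr_ge0// ltW// theta_gt0.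
Qed.

(** The multiplier term of the energy is at most [th k * energy 0] and carries the factor [th k]
    itself, so that factor cancels. *)
Lemma multiplier_le k : enorm (lam k - lams) <= Num.sqrt (2 * energy 0).
Proof.
rewrite -[leLHS]ger0_norm ?enorm_ge0// -sqrtr_sqr ler_wsqrtr//.
have t0 := theta_gt0 hc k.
have q0 := quad_terms_ge0 k; have g0 := gap_ge0 k.
have Ek := energy_le k; rewrite [energy k]/energy in Ek.
have : th k * (enorm (lam k - lams) ^+ 2 / 2) <= th k * energy 0.
  by lra.
by rewrite ler_pM2l// => L2; lra.
Qed.

(** [lam k - (th k)^-1 *: res k] is invariant: as [1 + al k] is the ratio of consecutive values of
    [th], each multiplier increment is a difference of scaled residuals. *)
Lemma multiplier_telescope k :
  lam k - lam 0 = (th k)^-1 *: res k - res 0.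
Proof.
case: halg => _ Aw _ _ Av Alam.
elim: k => [|k IH]; first by rewrite /th theta_init// invr1 scale1r !subrr.
have a0 := alpha_gt0 hc k; have t0 := theta_gt0 hc k.+1.
rewrite [lam k.+1]Alam addrAC IH (Av k) (Aw k) /res /residual.
rewrite /th -(theta_step hc k) -/th.
rewrite !mulmxDr -!scalemxAr !mulmxBr -/x -/y.
move: (pA P *m x k.+1) (pA P *m x k) (pB P *m y k.+1) (pB P *m y k).
move: (pA P *m x 0) (pB P *m y 0).
move=> X Y X1 X0 Y1 Y0; apply/colP => i; rewrite !mxE.
by field; rewrite !gt_eqF// addr_gt0.
Qed.

Lemma residual_le k : enorm (res k) <=
  th k * (Num.sqrt (2 * energy 0) + (enorm (lam 0 - lams) + enorm (res 0))).
Proof.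
have t0 := theta_gt0 hc k.
have -> : res k = th k *: ((lam k - lams) + (- (lam 0 - lams) + res 0)).
  have -> (a b d e : 'cV[R]_r) : (a - b) + (- (d - b) + e) = a - d + e.
    by rewrite opprB !addrA subrK.
  by rewrite multiplier_telescope subrK scalerA mulfV ?gt_eqF// scale1r.
rewrite enormZ gtr0_norm// ler_wpM2l ?(ltW t0)//.
rewrite (le_trans (ler_enormD _ _))// lerD ?multiplier_le//.
by rewrite (le_trans (ler_enormD _ _))// enormN.
Qed.

End Decay.

(** * Equivalence and rates, including initial guesses of infinite energy *)

Theorem theorem3p2 (R : realType) (m n r : nat) (P : problem R m n r)
    (xs : 'cV[R]_m) (ys : 'cV[R]_n) (lams : 'cV[R]_r)
    (c : params R) (s : iterates R m n r) (lbar : nat -> 'cV[R]_r)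
    (hP : convex_problem P)
    (hsaddle : saddle_point P xs ys lams)
    (hFs : (objective P xs ys < +oo)%E)
    (hc : param_system c)
    (hmu_f : 0 <= mu_f c) (hmu_g : 0 <= mu_g c) :
  (pX P (it_x s 0) -> (pf P (it_x s 0) < +oo)%E ->
     (scheme_G P c s lbar /\ lbar_choice P c s lbar <-> algorithm P c s lbar))
  /\
  (strongly_convex_on (pX P) (mu_f c) (pf P) ->
   strongly_convex_on (pY P) (mu_g c) (pg P) ->
   (0 < mu_f c -> gamma c 0 = mu_f c) ->
   (0 < mu_g c -> beta c 0 = mu_g c) ->
   (forall k, alpha c k ^+ 2 * opnorm (pA P) ^+ 2 = gamma c k * theta c k) ->
   algorithm P c s lbar ->
   let E0 := lyapunov P c s xs ys lams 0 in
   let R0 := R_zero P c s xs ys lams in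
   let Q := opnorm (pA P) + Num.sqrt (gamma c 0) in
   (forall k, pX P (it_x s k.+1) /\ pY P (it_y s k.+1)) /\
   (forall k,
      [/\ ((enorm (residual P (it_x s k) (it_y s k)))%:E
             <= (theta c k)%:E * R0)%E,
          (lagr P (it_x s k) (it_y s k) lams - lagr P xs ys (it_lam s k)
             <= (theta c k)%:E * E0)%E,
          (`|objective P (it_x s k) (it_y s k) - objective P xs ys|
             <= (theta c k)%:E * (E0 + (enorm lams)%:E * R0))%E &
          theta c k <=
            Num.min (Q / (Q + Num.sqrt (gamma c 0) * k%:R))
                    (4 * Q ^+ 2 / (2 * Q + Num.sqrt (mu_f c) * k%:R) ^+ 2)])).
Proof.
split; first by move=> X0 f0; apply: scheme_G_algorithm.
move=> f_sc g_sc gamma0E _ stepE halg E0 R0 Q.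
split=> [k|k].
  split; first by case: (alg_optimal_x hP hc hmu_f halg k).
  by case: halg => /(_ k) [].
have t0 := theta_gt0 hc k.
have theta_le : theta c k <=
    Num.min (Q / (Q + Num.sqrt (gamma c 0) * k%:R))
            (4 * Q ^+ 2 / (2 * Q + Num.sqrt (mu_f c) * k%:R) ^+ 2).
  have N0 := opnorm_ge0 (pA P).
  by rewrite le_min (theta_le_linear hc hmu_f N0 stepE)
             (theta_le_quadratic hc hmu_f N0 gamma0E stepE).
(* Outside the domain, [E0] and [R0] are [+oo] and the three bounds are trivial because [theta] is
   positive. *)
have [E0y|E0y] := eqVneq (lagr P (it_x s 0) (it_y s 0) lams) +oo%E.
  have E0E : E0 = +oo%E.
    rewrite /E0 /lyapunov E0y (lagr_saddle hP hsaddle hFs).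
    by rewrite -(fineK (saddle_objective_fin hP hFs)).
  have R0E : R0 = +oo%E by rewrite /R0 /R_zero -/E0 E0E mulry gtr0_sg ?mul1e.
  (* When [lams] is 0 the product is 0 times [+oo], that is 0, so only its nonnegativity is used. *)
  have sumE : (E0 + (enorm lams)%:E * R0 = +oo)%E.
    rewrite E0E addye// gt_eqF// (@lt_le_trans _ _ 0%E) ?ltNy0//.
    by rewrite mule_ge0 ?lee_fin ?enorm_ge0// R0E.
  by split; rewrite ?sumE ?R0E ?E0E ?gt0_muley ?leey ?lte_fin.
have [X0 Y0 f0 g0] : [/\ pX P (it_x s 0), pY P (it_y s 0),
    pf P (it_x s 0) \is a fin_num & pg P (it_y s 0) \is a fin_num].
  by apply: (@lagr_fin _ _ _ _ _ hP _ _ lams 0); rewrite adde0 ltey.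
have x0 := conj X0 f0; have y0 := conj Y0 g0.
set e0 := energy P c s xs ys lams 0.
have E0E : E0 = e0%:E.
  exact: (lyapunovE hP hsaddle hFs hc hmu_f hmu_g halg x0 y0).
pose r0 := Num.sqrt (2 * e0) + (enorm (it_lam s 0 - lams)
  + enorm (residual P (it_x s 0) (it_y s 0))).
have R0E : R0 = r0%:E by rewrite /R0 /R_zero -/E0 E0E.
have gap_k := gap_le hP hsaddle hFs hc hmu_f hmu_g f_sc g_sc stepE halg x0 y0 k.
have res_k :=
  residual_le hP hsaddle hFs hc hmu_f hmu_g f_sc g_sc stepE halg x0 y0 k.
rewrite -/e0 -/r0 in gap_k res_k.
rewrite R0E E0E; split=> //.
  by rewrite (lagr_gapE hP hsaddle hFs hc hmu_f hmu_g halg x0 y0) -EFinM.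
rewrite (objective_gapE lams hP hFs hc hmu_f hmu_g halg x0 y0) -!(EFinM, EFinD).
rewrite lee_fin.
(* The objective error is the gap minus [dotp lams] of the residual; the two parts are bounded
   separately. *)
rewrite (le_trans (ler_normB _ _))// mulrDr lerD//.
  rewrite ger0_norm//.
  exact: (gap_ge0 hP hsaddle hFs hc hmu_f hmu_g halg x0 y0).
rewrite (le_trans (normr_dotp_le _ _))// mulrCA.
by rewrite ler_wpM2l ?enorm_ge0.
Qed.
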